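(* Let $n \geq 5$ and let $W$ be a self-annihilating linear subspace of $\Lambda^{2}(\mathbb{R}^n)$. Then: (1) $\dim W \leq n-1$, and equality $\dim W = n-1$ holds if and only if there exists a fixed vector $a \in \mathbb{R}^n$ such that every $2$-form in $W$ is of the form $a \wedge v$ for some $v \in \mathbb{R}^n$. (2) If there is no $a \in \mathbb{R}^n$ such that every $2$-form of $W$ is of the form $a \wedge v$ (with $v \in \mathbb{R}^n$), then $\dim W \leq 3$. Moreover, in this case $\dim W = 3$ if and only if $W$ is the linear span of $x_1 \wedge x_2,\ x_2 \wedge x_3,\ x_3 \wedge x_1$ for some linearly independent vectors $x_1, x_2, x_3 \in \mathbb{R}^n$.
   Context: $\Lambda^{2}(\mathbb{R}^n)$ denotes the space of $2$-forms (second exterior power) over $\mathbb{R}^n$. A linear subspace $W$ of $\Lambda^{2}(\mathbb{R}^n)$ is called self-annihilating if $w_1 \wedge w_2 = 0$ for any two $2$-forms $w_1, w_2 \in W$.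
   Formalization: In (1) the ''if'' direction is false as written (take W = 0 or any proper subspace of the forms a∧v); the formal statement says dim W = n−1 if and only if, for some nonzero a, W is exactly the set of all a∧v with v in R^n. *)

(* Defs.v *)
From HB Require Import structures.
From mathcomp Require Import all_boot all_order all_algebra.

Set Implicit Arguments.
Unset Strict Implicit.
Unset Printing Implicit Defensive.

Import GRing.Theory.
Local Open Scope ring_scope.

(* The exterior algebra of F^n, in coordinates: w : exterior F n stands for
   \sum_A w A *: e_A, where for A = {i1 < ... < ik} the basis vector e_A is
   e_i1 /\ ... /\ e_ik. *)
Notation exterior F n := {ffun {set 'I_n} -> F^o}.

Definition ebase (F : fieldType) (n : nat) (A : {set 'I_n}) : exterior F n :=
  [ffun B => (B == A)%:R].

(* Number of transpositions of adjacent factors needed to sort the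
   concatenation of the increasing enumerations of A and B. *)
Definition inversions (n : nat) (A B : {set 'I_n}) : nat :=
  \sum_(i in A) \sum_(j in B) (j < i)%N.

Definition wedge (F : fieldType) (n : nat) (u v : exterior F n) :
    exterior F n :=
  [ffun C : {set 'I_n} => \sum_(A : {set 'I_n} | A \subset C)
     (-1) ^+ inversions A (C :\: A) * (u A * v (C :\: A))].

Definition extpow (F : fieldType) (n k : nat) : {vspace exterior F n} :=
  <<[seq ebase F A | A in [pred A : {set 'I_n} | #|A| == k]]>>%VS.

Definition extvec (F : fieldType) (n : nat) (a : 'rV[F]_n) : exterior F n :=
  \sum_(i < n) a 0 i *: ebase F [set i].

Definition self_annihilating (F : fieldType) (n : nat)
    (W : {vspace exterior F n}) : Prop :=
  forall w1 w2 : exterior F n, w1 \in W -> w2 \in W -> wedge w1 w2 = 0.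

Section Theory.
Variables (F : fieldType) (n : nat).
Implicit Types (u v w : exterior F n) (A B C : {set 'I_n}).

Lemma exterior_sum u : u = \sum_A u A *: ebase F A.
Proof.
apply/ffunP=> B; rewrite sum_ffunE (bigD1 B) //= !ffunE eqxx.
rewrite big1 ?addr0 => [|A neA]; first by rewrite /GRing.scale /= mulr1.
by rewrite !ffunE eq_sym (negPf neA) scaler0.
Qed.

Lemma wedge_linearl v : linear (fun u => wedge u v).
Proof.
move=> c u u'; apply/ffunP=> C; rewrite !ffunE /GRing.scale /= mulr_sumr.
rewrite -big_split; apply: eq_bigr => A _ /=; rewrite !ffunE /GRing.scale /=.
by rewrite mulrDl mulrDr !mulrA (mulrC _ c).
Qed.

Lemma wedge_linearr u : linear (wedge u).
Proof.
move=> c v v'; apply/ffunP=> C; rewrite !ffunE /GRing.scale /= mulr_sumr.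
rewrite -big_split; apply: eq_bigr => A _ /=; rewrite !ffunE /GRing.scale /=.
by rewrite mulrDr mulrDr !mulrA (mulrAC _ _ c) (mulrC _ c).
Qed.

Lemma wedge_ebase A B : wedge (ebase F A) (ebase F B) =
  if [disjoint A & B] then (-1) ^+ inversions A B *: ebase F (A :|: B) else 0.
Proof.
apply/ffunP=> C; rewrite ffunE.
have [sAC|nsAC] := boolP (A \subset C); last first.
  rewrite big1 => [|D sDC]; last first.
    rewrite !ffunE; case: eqP => [eDA|_]; last by rewrite mul0r mulr0.
    by rewrite eDA in sDC; rewrite sDC in nsAC.
  case: ifP => _; rewrite !ffunE //; case: eqP => [eC|_].
    by rewrite eC subsetUl in nsAC.
  by rewrite scaler0.
rewrite (bigD1 A) //= big1 ?addr0 => [|D /andP[_ neDA]]; last first.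
  by rewrite !ffunE (negPf neDA) mul0r mulr0.
rewrite !ffunE eqxx mul1r; case: eqP => [<-|neB].
  have -> : [disjoint A & C :\: A].
    by rewrite -setI_eq0 setIDA setDIl setDv set0I.
  by rewrite !ffunE setDE setUIr setUCr setIT (setUidPr sAC) eqxx.
rewrite mulr0; case: ifP => dAB; rewrite !ffunE //.
case: eqP => [eC|_]; last by rewrite scaler0.
by case: neB; rewrite eC setDUl setDv set0U; apply/setDidPl; rewrite disjoint_sym.
Qed.

Lemma inversionsUl A B C : [disjoint A & B] ->
  inversions (A :|: B) C = (inversions A C + inversions B C)%N.
Proof.
by move=> dAB; rewrite /inversions -bigU //; apply: eq_bigl => i; rewrite !inE.
Qed.

Lemma inversionsUr A B C : [disjoint B & C] ->
  inversions A (B :|: C) = (inversions A B + inversions A C)%N.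
Proof.
move=> dBC; rewrite -big_split; apply: eq_bigr => i _ /=; rewrite -bigU //.
by apply: eq_bigl => j; rewrite !inE.
Qed.

HB.instance Definition _ u :=
  GRing.isLinear.Build F (exterior F n) (exterior F n) _ _ (wedge_linearr u).

Definition wedger v u := wedge u v.

HB.instance Definition _ v :=
  GRing.isLinear.Build F (exterior F n) (exterior F n) _ (wedger v)
    (wedge_linearl v).

Lemma wedgeZl c u v : wedge (c *: u) v = c *: wedge u v.
Proof. by rewrite -[LHS]/(wedger v (c *: u)) linearZ. Qed.

Lemma wedge_suml (I : finType) (f : I -> exterior F n) v :
  wedge (\sum_i f i) v = \sum_i wedge (f i) v.
Proof. by rewrite -[LHS]/(wedger v (\sum_i f i)) linear_sum. Qed.

Lemma wedgeA : associative (@wedge F n).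
Proof.
move=> u v w.
rewrite (exterior_sum u) !wedge_suml; apply: eq_bigr => A _.
rewrite (exterior_sum v) !(wedge_suml, linear_sum) /=; apply: eq_bigr => B _.
rewrite (exterior_sum w) !linear_sum /=; apply: eq_bigr => C _.
rewrite !(wedgeZl, linearZ) /= !wedgeZl scalerA [v B * _]mulrC -scalerA.
do 3 congr (_ *: _); rewrite !wedge_ebase.
have disjUr (D E G : {set 'I_n}) : [disjoint D & E :|: G] = [disjoint D & E] && [disjoint D & G].
  by rewrite -!setI_eq0 setIUr setU_eq0.
have disjUl (D E G : {set 'I_n}) : [disjoint E :|: G & D] = [disjoint E & D] && [disjoint G & D].
  by rewrite -!setI_eq0 setIUl setU_eq0.
have w0 (x : exterior F n) : wedge 0 x = 0 by rewrite -[LHS]/(wedger x 0) linear0.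
have [dAB|/negPf ndAB] := boolP [disjoint A & B];
  have [dBC|/negPf ndBC] := boolP [disjoint B & C];
  rewrite ?w0 ?linear0 ?wedgeZl ?linearZ /= ?wedge_ebase ?disjUr ?disjUl
    ?dAB ?dBC ?ndAB ?ndBC ?andbF ?andbT ?scaler0 //=.
case: ifP => dAC; rewrite ?scaler0 // !scalerA -!exprD setUA.
by rewrite inversionsUl // inversionsUr // addnC addnA.
Qed.

Lemma wedge_vecC (a b : 'rV[F]_n) :
  wedge (extvec a) (extvec b) = - wedge (extvec b) (extvec a).
Proof.
rewrite !wedge_suml; under eq_bigr do rewrite linear_sum.
under [in RHS]eq_bigr do rewrite linear_sum.
rewrite exchange_big -sumrN; apply: eq_bigr => i _ /=.
rewrite -sumrN; apply: eq_bigr => j _.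
rewrite !(wedgeZl, linearZ) /=; do 2 congr (_ *: _); rewrite !wedge_ebase !disjoints1 !inE eq_sym.
case: eqP => [_|/eqP neij] /=; first by rewrite oppr0.
rewrite /inversions !big_set1 setUC -scaleNr; congr (_ *: _).
move: neij; rewrite -val_eqE /=; case: ltngtP => // _ _.
by rewrite expr0 expr1 opprK.
Qed.

Lemma mem_extpow k w :
  reflect (forall A, #|A| != k -> w A = 0) (w \in extpow F n k).
Proof.
apply: (iffP idP) => [/coord_span -> A nAk|w0].
  rewrite sum_ffunE big1 // => i _; rewrite ffunE -tnth_nth.
  set t := image_tuple _ _; have /imageP[B] := mem_tnth i t.
  rewrite inE => /eqP cB ->; rewrite ffunE.
  by case: eqP => [eAB|_]; [rewrite eAB cB eqxx in nAk | rewrite scaler0].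
rewrite (exterior_sum w); apply: rpred_sum => A _.
have [cA|/w0 ->] := eqVneq #|A| k; last by rewrite scale0r rpred0.
by apply/rpredZ/memv_span/imageP; exists A; rewrite ?inE ?cA.
Qed.

End Theory.

(* Main.v *)
(* Over the reals a 2-form w with w /\ w = 0 is a product: contracting by a
   coordinate functional gives the vector a := i_f w with 2 a /\ w = 0, and if
   f a = 1 then a /\ w = 0 forces w = a /\ i_f w.  So W consists of planes any
   two of which share a line.  If no vector divides all of W, take p /\ a and
   p /\ b in W and a plane of W missing p; it meets both, so after subtracting
   multiples of p from a and b it is a /\ b.  Then W contains the triangle
   p /\ a, a /\ b, b /\ p, and a product meeting its three planes lies in its
   span.  Otherwise W lies in the image of v |-> a /\ v, of dimension n - 1. *)

From HB Require Import structures.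
Require Import Defs.
From mathcomp Require Import all_boot all_order all_algebra.
From mathcomp Require Import reals.

Set Implicit Arguments.
Unset Strict Implicit.
Unset Printing Implicit Defensive.

Import GRing.Theory Num.Theory.
Local Open Scope ring_scope.

(** * Vectors as 1-forms, and contraction by a coordinate *)

Section Contraction.
Variables (F : fieldType) (n : nat).
Implicit Types (u v w : exterior F n) (a b c : 'rV[F]_n) (A B C : {set 'I_n}).

Lemma extvec_linear : linear (@extvec F n).
Proof.
move=> c a b; rewrite /extvec scaler_sumr -big_split /=.
by apply: eq_bigr => i _; rewrite !mxE scalerDl scalerA.
Qed.

HB.instance Definition _ := GRing.isLinear.Build F 'rV[F]_n (exterior F n) _
  (@extvec F n) extvec_linear.

Lemma extvecE a A : extvec a A = \sum_(i | A == [set i]) a 0 i.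
Proof.
rewrite sum_ffunE [RHS]big_mkcond /=; apply: eq_bigr => i _.
by rewrite !ffunE; case: eqP; rewrite /GRing.scale /= ?mulr1 ?mulr0.
Qed.

Lemma extvec1E a (i : 'I_n) : extvec a [set i] = a 0 i.
Proof.
rewrite extvecE (big_pred1 i) // => j; rewrite /= eq_sym.
by rewrite (inj_eq set1_inj).
Qed.

Lemma extvec_inj : injective (@extvec F n).
Proof. by move=> a b ab; apply/rowP=> i; rewrite -!extvec1E ab. Qed.

Lemma extvec_eq0 a : (extvec a == 0) = (a == 0).
Proof. by rewrite -(inj_eq extvec_inj) linear0. Qed.

Lemma mem_extpow1 w : w \in extpow F n 1 -> exists a, w = extvec a.
Proof.
move=> /mem_extpow w0; exists (\row_i w [set i]); apply/ffunP=> A.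
have [/cards1P[i ->]|/[dup] /w0 -> nA] := boolP (#|A| == 1%N).
  by rewrite extvec1E mxE.
rewrite extvecE big_pred0 // => i; apply: contraNF nA => /eqP ->.
by rewrite cards1.
Qed.

Lemma extvec_delta (i : 'I_n) : extvec (delta_mx 0 i) = ebase F [set i].
Proof.
rewrite /extvec (bigD1 i) //= mxE !eqxx scale1r big1 ?addr0 // => j ji.
by rewrite mxE (negPf ji) andbF scale0r.
Qed.

Lemma wedge0l u : wedge 0 u = 0.
Proof. exact: (linear0 (wedger u)). Qed.

Lemma wedgeDl u v w : wedge (u + v) w = wedge u w + wedge v w.
Proof. exact: (linearD (wedger w)). Qed.

Lemma wedgeNl u v : wedge (- u) v = - wedge u v.
Proof. exact: (linearN (wedger v)). Qed.

Lemma wedge0r u : wedge u 0 = 0.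
Proof. exact: linear0. Qed.

Lemma wedgeDr u v w : wedge u (v + w) = wedge u v + wedge u w.
Proof. exact: linearD. Qed.

Lemma wedgeNr u v : wedge u (- v) = - wedge u v.
Proof. exact: linearN. Qed.

Lemma wedgeZr k u v : wedge u (k *: v) = k *: wedge u v.
Proof. exact: linearZ. Qed.

Lemma wedge1r u : wedge u (@ebase F n set0) = u.
Proof.
rewrite {2}(exterior_sum u) [in LHS](exterior_sum u) wedge_suml.
apply: eq_bigr => A _; rewrite wedgeZl wedge_ebase -setI_eq0 setI0 eqxx.
rewrite setU0 /inversions big1 ?expr0 ?scale1r // => i _.
by rewrite big_set0.
Qed.

Lemma wedge_extvecE a u C : wedge (extvec a) u C =
  \sum_(i in C) (-1) ^+ inversions [set i] (C :\ i) * (a 0 i * u (C :\ i)).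
Proof.
rewrite /extvec wedge_suml sum_ffunE [RHS]big_mkcond /=; apply: eq_bigr => i _.
rewrite wedgeZl ffunE [X in _ *: X]ffunE.
case: ifP => [iC|iC]; last first.
  rewrite big1 ?scaler0 // => A AC; rewrite ffunE; case: eqP => [eA|_].
    by rewrite eA sub1set iC in AC.
  by rewrite mul0r mulr0.
rewrite (bigD1 [set i]) ?sub1set //= big1 ?addr0 => [|A /andP[_ /negPf nA]].
  by rewrite ffunE eqxx mul1r /GRing.scale /= mulrCA.
by rewrite ffunE nA mul0r mulr0.
Qed.

(* Interior product with the i-th coordinate functional. *)
Definition contract1 (i : 'I_n) u : exterior F n :=
  [ffun C : {set 'I_n} => if i \in C then 0
    else (-1) ^+ inversions [set i] C * u (i |: C)].

Lemma contract1_linear i : linear (contract1 i).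
Proof.
move=> c u v; apply/ffunP=> C; rewrite !ffunE; case: ifP => _.
  by rewrite scaler0 addr0.
by rewrite /GRing.scale /= mulrDr mulrCA.
Qed.

HB.instance Definition _ i := GRing.isLinear.Build F (exterior F n)
  (exterior F n) _ (contract1 i) (contract1_linear i).

Lemma inversions1U (i j : 'I_n) C : j \notin C ->
  inversions [set i] (j |: C) = ((j < i) + inversions [set i] C)%N.
Proof.
by move=> jC; rewrite inversionsUr ?disjoints1 // /inversions !big_set1.
Qed.

(** Coefficients at [C] are compared. If [i] lies in [C], the two terms on the right cancel;
    otherwise the summand at [i] on the left gives [a 0 i *: u], and the others match up to sign. *)
Lemma contract1_wedge i a u :
  contract1 i (wedge (extvec a) u) =
  a 0 i *: u - wedge (extvec a) (contract1 i u).
Proof.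
apply/ffunP=> C; rewrite ffunE [RHS]ffunE [X in _ + X]ffunE.
rewrite !wedge_extvecE ffunE.
have sgn m : (-1) ^+ m * (-1) ^+ m = 1 :> F by rewrite -expr2 sqrr_sign.
case: ifP => iC.
  rewrite (bigD1 i) //= ffunE !inE eqxx /= setD1K // big1 => [|j /andP[jC ji]].
    by rewrite addr0 mulrCA [X in _ * X]mulrA sgn mul1r subrr.
  by rewrite ffunE !inE eq_sym ji iC /= !mulr0.
rewrite big_setU1 ?iC //= mulrDr setU1K ?iC // mulrA sgn mul1r.
congr (_ + _); rewrite mulr_sumr -sumrN; apply: eq_bigr => j jC.
have ij : i != j by apply: contraFneq iC => ->.
rewrite ffunE !inE iC andbF -{1}(setD1K jC) inversions1U ?inE ?eqxx //.
have -> : (i |: C) :\ j = i |: C :\ j.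
  by apply/setP=> k; rewrite !inE; case: (k =P i) => // ->; rewrite ij.
rewrite inversions1U ?inE ?iC ?andbF //.
rewrite !exprD; set s := (-1) ^+ inversions _ _.
set t := (-1) ^+ inversions _ _.
(* Moving [i] past [j] and moving [j] past [i] differ by one transposition, whence the minus sign of
   the rule. *)
have -> : (-1) ^+ (j < i)%N = - (-1) ^+ (i < j)%N :> F.
  by move: ij; rewrite -val_eqE; case: ltngtP => //=;
     rewrite ?expr0 ?expr1 ?opprK.
have E (e x y z p : F) : e * e = 1 ->
    - e * x * (e * y * (z * p)) = - (y * (z * (x * p))).
  move=> ee; rewrite !mulNr mulrACA [e * (e * y)]mulrA ee mul1r.
  by rewrite [x * (_ * _)]mulrCA.
exact: E.
Qed.

End Contraction.

(** * Products of vectors and linear independence *)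

Section Products.
Variables (F : numFieldType) (n : nat).
Implicit Types (u v w : exterior F n) (a b c : 'rV[F]_n) (A B C : {set 'I_n}).
Implicit Types (s : seq 'rV[F]_n).

(** Characteristic zero enters here, through division by 2. *)
Lemma exterior_addself_eq0 u : u + u = 0 -> u = 0.
Proof.
move=> u2; have : 2%:R *: u = 0 by rewrite scaler_nat mulr2n.
by move/eqP; rewrite scaler_eq0 pnatr_eq0 => /eqP.
Qed.

Lemma wedge_sq a : wedge (extvec a) (extvec a) = 0.
Proof.
by apply: exterior_addself_eq0; rewrite {1}wedge_vecC addNr.
Qed.

Lemma wedge_vecK a u : wedge (extvec a) (wedge (extvec a) u) = 0.
Proof. by rewrite wedgeA wedge_sq wedge0l. Qed.

Lemma wedge_vecCA a b u : wedge (extvec a) (wedge (extvec b) u) =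
  - wedge (extvec b) (wedge (extvec a) u).
Proof. by rewrite !wedgeA wedge_vecC wedgeNl. Qed.

(* Interior product with the functional f, junk when f is not linear. *)
Definition contract (f : 'rV[F]_n -> F) u : exterior F n :=
  \sum_i f (delta_mx 0 i) *: contract1 i u.

Lemma contract_wedge (f : {scalar 'rV[F]_n}) a u :
  contract f (wedge (extvec a) u) =
  f a *: u - wedge (extvec a) (contract f u).
Proof.
rewrite {2}[a]row_sum_delta (linear_sum f) /= scaler_suml linear_sum /=.
rewrite -sumrB; apply: eq_bigr => i _; rewrite contract1_wedge scalerBr.
by rewrite linearZ /= [f (_ *: _)]linearZ /= scalerA wedgeZr.
Qed.

Lemma contract1_set0 i : contract1 i (ebase F set0) = 0 :> exterior F n.
Proof.
apply/ffunP=> C; rewrite !ffunE; case: ifP => // _.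
have -> : (i |: C == set0) = false.
  by apply/negbTE/set0Pn; exists i; rewrite !inE eqxx.
by rewrite mulr0.
Qed.

(** Starting from the unit [ebase F set0] makes the empty product nonzero, in accordance with the
    empty family being free. *)
Definition extprod s : exterior F n :=
  foldr (fun a u => wedge (extvec a) u) (ebase F set0) s.

Lemma contract_extprod (f : {scalar 'rV[F]_n}) s :
  {in s, forall a, f a = 0} -> contract f (extprod s) = 0.
Proof.
elim: s => [|a s IHs] fs /=.
  by rewrite /contract big1 // => i _; rewrite contract1_set0 scaler0.
rewrite contract_wedge fs ?mem_head // IHs ?wedge0r ?scale0r ?subr0 //.
by move=> b bs; apply: fs; rewrite inE bs orbT.
Qed.

Lemma wedge_extprod_mem a s : a \in s -> wedge (extvec a) (extprod s) = 0.
Proof.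
elim: s => //= b s IHs; rewrite inE => /predU1P[->|/IHs as0].
  exact: wedge_vecK.
by rewrite wedge_vecCA as0 linear0 oppr0.
Qed.

Lemma wedge_extprod_span a s : a \in <<s>>%VS ->
  wedge (extvec a) (extprod s) = 0.
Proof.
move=> /(@coord_span _ _ _ (in_tuple s)) ->.
rewrite linear_sum wedge_suml big1 //= => i _.
by rewrite linearZ wedgeZl wedge_extprod_mem ?scaler0 // mem_nth.
Qed.

Lemma free_dual a s : free (a :: s) ->
  exists2 f : {scalar 'rV[F]_n}, f a = 1 & {in s, forall b, f b = 0}.
Proof.
move=> fr; pose X := in_tuple (a :: s).
exists (coord X ord0); first exact: (coord_free (X := X) ord0 ord0 fr).
move=> b bs; have bi : ((index b s).+1 < (size s).+1)%N.
  by rewrite ltnS index_mem.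
by have := coord_free (X := X) (Ordinal bi) ord0 fr; rewrite /= nth_index.
Qed.

(** By induction on [s]: a vector in the span of the others kills their product; for a free family,
    contracting by the functional of [free_dual] strips off the first factor and recovers the
    nonzero product of the rest. *)
Lemma extprod_neq0 s : (extprod s != 0) = free s.
Proof.
elim: s => [|a s IHs].
  rewrite nil_free; apply/eqP=> /ffunP/(_ set0); rewrite !ffunE eqxx => /eqP.
  by rewrite oner_eq0.
apply/idP/idP => [as0|fr].
  rewrite free_cons -IHs; apply/andP; split.
    by apply: contraNN as0 => /wedge_extprod_span /= ->.
  by apply: contraNneq as0 => /= ->; rewrite linear0.
have [f fa fs] := free_dual fr; apply: contraTneq fr => /= as0.
rewrite free_cons -IHs.
have := contract_wedge f a (extprod s); rewrite as0 contract_extprod //.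
rewrite linear0 subr0 fa scale1r /contract => <-.
by rewrite big1 ?eqxx ?andbF // => i _; rewrite linear0 scaler0.
Qed.

(** * Division of 2-forms by vectors, and decomposability *)

Lemma contract0 f : contract f 0 = 0.
Proof. by rewrite /contract big1 // => i _; rewrite linear0 scaler0. Qed.

Lemma contract1_extpow i k w :
  w \in extpow F n k.+1 -> contract1 i w \in extpow F n k.
Proof.
move=> /mem_extpow w0; apply/mem_extpow => A nA; rewrite ffunE.
case: ifPn => // iA; rewrite w0 ?mulr0 //.
by rewrite cardsU1 iA add1n eqSS.
Qed.

Lemma contract_extpow f k w :
  w \in extpow F n k.+1 -> contract f w \in extpow F n k.
Proof.
by move=> wk; apply: rpred_sum => i _; rewrite rpredZ ?contract1_extpow.
Qed.

Lemma wedge_div a w : a != 0 -> w \in extpow F n 2 ->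
  wedge (extvec a) w = 0 -> exists b, w = wedge (extvec a) (extvec b).
Proof.
rewrite -seq1_free => /free_dual[f fa _] w2 aw.
have [b wb] := mem_extpow1 (contract_extpow f w2); exists b.
have := contract_wedge f a w; rewrite aw contract0 fa scale1r wb.
by move/esym/subr0_eq.
Qed.

Lemma extpow2_ind (P : exterior F n -> Prop) :
  (forall u v, P u -> P v -> P (u + v)) ->
  (forall a b, P (wedge (extvec a) (extvec b))) ->
  forall w, w \in extpow F n 2 -> P w.
Proof.
move=> PD Pw w /mem_extpow w0; rewrite (exterior_sum w).
have P0 : P 0 by have := Pw 0 0; rewrite linear0 wedge0l.
apply: (big_ind P) => // A _.
have [/cards2P[i [j [ij ->]]]|/w0 ->] := boolP (#|A| == 2); last first.
  by rewrite scale0r.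
(* The coefficient and the sorting sign are absorbed into the first vector, so [P] has to be closed
   under sums only. *)
have := Pw ((w [set i; j] * (-1) ^+ inversions [set i] [set j]) *: delta_mx 0 i)
           (delta_mx 0 j).
rewrite linearZ /= !extvec_delta wedgeZl wedge_ebase disjoints1 inE ij.
by rewrite scalerA -mulrA -expr2 sqrr_sign mulr1.
Qed.

Lemma contract1_vec i a : contract1 i (extvec a) = a 0 i *: ebase F set0.
Proof.
by rewrite -[extvec a]wedge1r contract1_wedge contract1_set0 linear0 subr0.
Qed.

Lemma wedge_vec2C a w : w \in extpow F n 2 ->
  wedge w (extvec a) = wedge (extvec a) w.
Proof.
move: w; apply: extpow2_ind => [u v uC vC|b c].
  by rewrite wedgeDl uC vC linearD.
by rewrite -wedgeA [wedge (extvec c) _]wedge_vecC linearN wedge_vecCA.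
Qed.

(** The sign of the Leibniz rule is plus because [w] has even degree: on a product of two vectors
    [contract1_wedge] is applied twice. *)
Lemma contract1_wedge2 i w u : w \in extpow F n 2 ->
  contract1 i (wedge w u) = wedge (contract1 i w) u + wedge w (contract1 i u).
Proof.
move: w; apply: extpow2_ind => [v w vE wE|a b].
  by rewrite wedgeDl !linearD /= vE wE !wedgeDl addrACA.
rewrite -wedgeA !contract1_wedge contract1_vec linearZ linearB linearZ /=.
rewrite wedge1r wedgeDl wedgeNl !wedgeZl -wedgeA.
by rewrite opprB addrA addrAC.
Qed.

Lemma decomposable w : w \in extpow F n 2 -> wedge w w = 0 ->
  exists a b, w = wedge (extvec a) (extvec b).
Proof.
move=> w2 ww.
have [->|] := eqVneq w 0; first by exists 0, 0; rewrite linear0 wedge0l.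
(* A nonzero coefficient of [w] at a pair [i], [j] is, up to sign, the coefficient at [j] of the
   contraction by [i]. *)
move=> w0; have [i] : exists i, contract1 i w != 0.
  apply/existsP; apply: contraR w0; rewrite negb_exists => /forallP w0.
  apply/eqP/ffunP=> A; rewrite ffunE.
  have [/cards2P[i [j [ij ->]]]|nA] := boolP (#|A| == 2); last first.
    by have /mem_extpow -> := w2.
  have /negPn/eqP/ffunP/(_ [set j]) := w0 i; rewrite !ffunE inE (negPf ij).
  by move/eqP; rewrite mulf_eq0 signr_eq0 => /eqP.
have [a aE] := mem_extpow1 (contract1_extpow i w2).
rewrite aE extvec_eq0 => a0; exists a; apply: wedge_div => //.
have := contract1_wedge2 i w w2; rewrite ww linear0 aE (wedge_vec2C _ w2).
by move/esym/exterior_addself_eq0.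
Qed.

(** * Planes that meet in a line *)

Lemma extprod2 a b : extprod [:: a; b] = wedge (extvec a) (extvec b).
Proof. by rewrite /= wedge1r. Qed.

Lemma extprod3 a b c :
  extprod [:: a; b; c] = wedge (extvec a) (wedge (extvec b) (extvec c)).
Proof. by rewrite /= wedge1r. Qed.

Lemma mem_span_extprod a s :
  extprod s != 0 -> wedge (extvec a) (extprod s) = 0 -> a \in <<s>>%VS.
Proof.
rewrite extprod_neq0 => fs as0; have /negbT : (extprod (a :: s) != 0) = false.
  by rewrite /= as0 eqxx.
by rewrite extprod_neq0 free_cons fs andbT negbK.
Qed.

(** If [w] is the product of [c] and [d], then [p], [c], [d] are free and [a] lies in their span;
    removing its component along [p] leaves a vector of the plane of [w]. *)
Lemma shift_annihilates p a w : w \in extpow F n 2 -> wedge w w = 0 ->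
    wedge (extvec p) w != 0 -> wedge (extvec p) (wedge (extvec a) w) = 0 ->
  exists k, wedge (extvec (a - k *: p)) w = 0.
Proof.
move=> w2 /(decomposable w2)[c [d ->]]; rewrite -extprod2 => pw paw.
have : a \in <<p :: [:: c; d]>>%VS.
  by apply: mem_span_extprod; rewrite //= wedge_vecCA paw oppr0.
rewrite span_cons => /memv_addP[_ /vlineP[k ->] [b bcd ->]].
by exists k; rewrite addrC addKr wedge_extprod_span.
Qed.

(** The plane of [w] misses [p] but meets the planes of [p], [a] and of [p], [b]; the shifted [a]
    and [b] lie in it and are independent, so they span it. *)
Lemma meet_planes p a b w : w \in extpow F n 2 -> wedge w w = 0 ->
    free [:: p; a; b] -> wedge (extvec p) w != 0 ->
    wedge (extvec p) (wedge (extvec a) w) = 0 ->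
    wedge (extvec p) (wedge (extvec b) w) = 0 ->
  exists k l m, [/\ m != 0, free [:: p; a - k *: p; b - l *: p] &
    w = m *: wedge (extvec (a - k *: p)) (extvec (b - l *: p))].
Proof.
move=> w2 ww fr pw paw pbw.
have [k aw] := shift_annihilates w2 ww pw paw.
have [l bw] := shift_annihilates w2 ww pw pbw.
exists k, l; set a' := a - _ in aw *; set b' := b - _ in bw *.
(* Shifting [a] and [b] along [p] does not change the product of the three vectors. *)
have fr' : free [:: p; a'; b'].
  move: fr; rewrite -!extprod_neq0 !extprod3.
  have E c t : extvec (c - t *: p) = extvec c - t *: extvec p.
    by rewrite linearB linearZ.
  rewrite /a' /b' !E wedgeDl wedgeNl wedgeZl wedgeDr wedgeNr wedgeZr wedge_vecK.
  rewrite scaler0 subr0 !(wedgeDr, wedgeNr, wedgeZr)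
    [wedge _ (wedge (extvec a) (extvec p))]wedge_vecCA.
  by rewrite wedge_sq wedge0r oppr0 scaler0 subr0.
clearbody a' b'.
have : free [:: a'; b'] by move: fr'; rewrite free_cons => /andP[].
rewrite -extprod_neq0 => ab0.
have a0 : a' != 0.
  by apply: contraNneq ab0 => -> /=; rewrite linear0 wedge0l.
have [z wE] := wedge_div a0 w2 aw.
(* Since [b'] also kills [w], the cofactor [z] depends on [a'] and [b']; only its [b'] component
   contributes to [w]. *)
have : z \in <<[:: a'; b']>>%VS.
  apply: mem_span_extprod => //; rewrite extprod2 wedge_vecCA.
  by rewrite [wedge (extvec z) _]wedge_vecC wedgeNr opprK wedge_vecCA
    -wE bw oppr0.
rewrite span_cons span_seq1 => /memv_addP[_ /vlineP[s ->] [_ /vlineP[t ->] zE]].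
have {}wE : w = t *: wedge (extvec a') (extvec b').
  by rewrite wE zE [extvec (_ + _)]linearD /= wedgeDr
    ![extvec (_ *: _)]linearZ /= !wedgeZr wedge_sq scaler0 add0r.
exists t; split=> //; apply: contraNneq pw => t0.
by rewrite wE t0 scale0r wedge0r.
Qed.


(** * Stars: 2-forms divisible by a fixed vector *)

Definition in_star a (W : {vspace exterior F n}) : Prop :=
  forall w, w \in W -> exists b, w = wedge (extvec a) (extvec b).

Definition star a : {vspace exterior F n} :=
  limg (linfun (wedge (extvec a) \o @extvec F n)).

Lemma mem_star a w :
  w \in star a <-> exists b, w = wedge (extvec a) (extvec b).
Proof.
split=> [/memv_imgP[b _ ->]|[b ->]]; first by exists b; rewrite lfunE.
by apply/memv_imgP; exists b; rewrite ?memvf ?lfunE.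
Qed.

(** Rank and nullity: the kernel of wedging vectors with [a] is the line of [a]. *)
Lemma dim_star a : a != 0 -> \dim (star a) = (n - 1)%N.
Proof.
move=> a0.
have kerE : lker (linfun (wedge (extvec a) \o @extvec F n)) = <[a]>%VS.
  apply/vspaceP=> b; rewrite memv_ker lfunE /=.
  apply/eqP/idP => [ab|/vlineP[k ->]]; last first.
    by rewrite linearZ wedgeZr wedge_sq scaler0.
  rewrite -span_seq1; apply: mem_span_extprod.
    by rewrite extprod_neq0 seq1_free.
  by rewrite /= wedge1r wedge_vecC ab oppr0.
have := limg_ker_dim (linfun (wedge (extvec a) \o @extvec F n)) fullv.
rewrite capfv kerE dim_vline a0 dimvf /dim /= mul1n.
exact: (canRL (addKn 1)).
Qed.

Lemma dim_in_star a W : in_star a W -> a != 0 -> (\dim W <= n - 1)%N.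
Proof.
move=> aW a0; rewrite -(dim_star a0); apply/dimvS/subvP=> w /aW ?.
exact/mem_star.
Qed.

Lemma in_star0 W : in_star 0 W -> W = 0%VS.
Proof.
move=> W0; apply/eqP; rewrite -subv0; apply/subvP=> w /W0[b ->].
by rewrite linear0 wedge0l mem0v.
Qed.

(** * Triangles: 2-forms over the span of three vectors *)

Definition triangle a b c : {vspace exterior F n} :=
  <<[:: wedge (extvec a) (extvec b); wedge (extvec b) (extvec c);
        wedge (extvec c) (extvec a)]>>%VS.

Lemma wedge_span u (s : seq (exterior F n)) :
  {in s, forall v, wedge u v = 0} -> {in <<s>>%VS, forall v, wedge u v = 0}.
Proof.
move=> us v /(@coord_span _ _ _ (in_tuple s)) ->.
rewrite linear_sum big1 //= => i _.
by rewrite wedgeZr us ?scaler0 // mem_nth.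
Qed.

(** Wedging with [c] kills the last two generators but not the first; wedging with [a] then
    separates the second from the third. *)
Lemma dim_triangle a b c : free [:: a; b; c] -> \dim (triangle a b c) = 3%N.
Proof.
rewrite -extprod_neq0 extprod3 => abc.
have cab : wedge (extvec c) (wedge (extvec a) (extvec b)) != 0.
  by rewrite wedge_vecCA [wedge (extvec c) _]wedge_vecC wedgeNr opprK.
suff /eqP : free [:: wedge (extvec a) (extvec b); wedge (extvec b) (extvec c);
                     wedge (extvec c) (extvec a)] by [].
rewrite !free_cons nil_free andbT span_nil memv0 span_seq1; apply/and3P; split.
- apply: contraNN cab => /wedge_span -> // w; rewrite !inE => /orP[] /eqP ->.
    by rewrite wedge_vecCA wedge_sq wedge0r oppr0.
  exact: wedge_vecK.
- apply: contraNN abc; rewrite -span_seq1 => /wedge_span -> // w.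
  by rewrite inE => /eqP ->; rewrite wedge_vecCA wedge_sq wedge0r oppr0.
apply: contraNN abc => /eqP ca; rewrite wedge_vecCA.
by rewrite [wedge (extvec a) (extvec c)]wedge_vecC ca oppr0 wedge0r oppr0.
Qed.

Lemma triangle_rot a b c : triangle b c a = triangle a b c.
Proof.
exact/eq_span/(mem_rot 1 [:: wedge _ _; wedge _ _; _]).
Qed.

(** By [meet_planes] with [a] as common vector, [w] is a multiple of a product of shifts of [b] and
    [c] along [a], which expands into the three generators. *)
Lemma mem_triangle_meet a b c w : free [:: a; b; c] ->
    w \in extpow F n 2 -> wedge w w = 0 -> wedge (extvec a) w != 0 ->
    wedge (wedge (extvec a) (extvec b)) w = 0 ->
    wedge (wedge (extvec c) (extvec a)) w = 0 ->
  w \in triangle a b c.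
Proof.
move=> fr w2 ww aw; rewrite -wedgeA => abw.
rewrite wedge_vecC wedgeNl -wedgeA => /eqP; rewrite oppr_eq0 => /eqP acw.
have [k [l [m [_ _ ->]]]] := meet_planes w2 ww fr aw abw acw.
have E d t : extvec (d - t *: a) = extvec d - t *: extvec a.
  by rewrite linearB linearZ.
apply: rpredZ; rewrite !E wedgeDl wedgeNl wedgeZl !(wedgeDr, wedgeNr, wedgeZr).
rewrite wedge_sq scaler0 oppr0 addr0 [wedge (extvec b) (extvec a)]wedge_vecC.
rewrite [wedge (extvec a) (extvec c)]wedge_vecC !scalerN !opprK.
by rewrite !rpredD ?rpredZ // memv_span // !inE eqxx ?orbT.
Qed.

Lemma mem_triangle a b c w : free [:: a; b; c] ->
    w \in extpow F n 2 -> wedge w w = 0 ->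
    {in triangle a b c, forall u, wedge u w = 0} ->
  w \in triangle a b c.
Proof.
move=> fr w2 ww uw.
have abw := uw _ (memv_span (mem_head _ _)).
have bcw : wedge (wedge (extvec b) (extvec c)) w = 0.
  by apply: uw; rewrite memv_span // !inE eqxx orbT.
have caw : wedge (wedge (extvec c) (extvec a)) w = 0.
  by apply: uw; rewrite memv_span // !inE eqxx !orbT.
have [aw|] := eqVneq (wedge (extvec a) w) 0; last first.
  by move=> aw; apply: mem_triangle_meet.
have [bw|bw] := eqVneq (wedge (extvec b) w) 0; last first.
  rewrite -triangle_rot; apply: mem_triangle_meet => //.
  by rewrite -[_ :: _]/(rot 1 [:: a; b; c]) (perm_free (permEl (perm_rot _ _))).
(* The remaining case has both [a] and [b] dividing [w], which makes it a multiple of their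
   product. *)
have : free [:: b; a].
  rewrite -(perm_free (permEl (perm_rot 1 [:: b; a]))).
  by move: fr; rewrite -[[:: a; b; c]]/([:: a; b] ++ [:: c]) => /catl_free.
rewrite -extprod_neq0 => ba0.
have a0 : a != 0.
  by apply: contraNneq ba0 => ->; rewrite extprod2 linear0 wedge0r.
have [z wE] := wedge_div a0 w2 aw.
have : z \in <<[:: b; a]>>%VS.
  apply: mem_span_extprod => //; rewrite extprod2 wedge_vecCA.
  by rewrite [wedge (extvec z) _]wedge_vecC wedgeNr opprK -wE.
rewrite span_cons span_seq1 => /memv_addP[_ /vlineP[s ->] [_ /vlineP[t ->] zE]].
rewrite wE zE [extvec (_ + _)]linearD /= wedgeDr ![extvec (_ *: _)]linearZ /=.
by rewrite !wedgeZr wedge_sq scaler0 addr0 rpredZ // memv_span // mem_head.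
Qed.

(** * The dichotomy between stars and triangles *)

Lemma in_star_or a W : (W <= extpow F n 2)%VS -> a != 0 ->
  in_star a W \/ exists2 w, w \in W & wedge (extvec a) w != 0.
Proof.
move=> /subvP W2 a0.
have [/subvP aW|/subvPn[w wW]] :=
    boolP (W <= lker (linfun (wedge (extvec a))))%VS;
    [left|rewrite memv_ker lfunE; right].
  move=> w wW; apply: wedge_div => //; first exact: W2.
  by have := aW _ wW; rewrite memv_ker lfunE /= => /eqP.
by exists w.
Qed.

Lemma star_or_triangle W : (W <= extpow F n 2)%VS -> self_annihilating W ->
  (exists a, in_star a W) \/
  exists a b c, free [:: a; b; c] /\ W = triangle a b c.
Proof.
move=> W2 Wann; have /subvP W2' := W2.
have [->|] := eqVneq W 0%VS.
  by left; exists 0 => w; rewrite memv0 => /eqP ->; exists 0;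
     rewrite linear0 wedge0l.
rewrite -vpick0; have := memv_pick W; set w0 := vpick W => w0W w0_neq0.
have [a [b w0E]] := decomposable (W2' _ w0W) (Wann _ _ w0W w0W).
have a0 : a != 0.
  by apply: contraNneq w0_neq0 => a0; rewrite w0E a0 linear0 wedge0l.
have [aW|[w1 w1W aw1]] := in_star_or W2 a0; first by left; exists a.
(* The planes of [w0] and [w1] meet; the shifted [b] is a common vector [p], and [w0], [w1] are
   rewritten as products having [p] as a factor. *)
have [k pw1] : exists k, wedge (extvec (b - k *: a)) w1 = 0.
  apply: shift_annihilates (aw1) _; [exact: W2'|exact: Wann|].
  by rewrite wedgeA -w0E Wann.
set p := b - _ in pw1.
have {}w0E : w0 = wedge (extvec a) (extvec p).
  rewrite w0E /p [extvec (_ - _)]linearB /= [extvec (_ *: _)]linearZ /=.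
  by rewrite wedgeDr wedgeNr wedgeZr wedge_sq scaler0 subr0.
clearbody p w0.
have p0 : p != 0.
  by apply: contraNneq w0_neq0 => p0; rewrite w0E p0 linear0 wedge0r.
have [v w1E] := wedge_div p0 (W2' _ w1W) pw1.
have fr : free [:: p; a; v].
  by rewrite -extprod_neq0 extprod3 wedge_vecCA -w1E oppr_eq0.
(* If [p] does not divide all of [W], some [w2] misses [p] and provides the third side of the
   triangle. *)
have [pW|[w2 w2W pw2]] := in_star_or W2 p0; first by left; exists p.
have [||k' [l [m [m0 fr' w2E]]]] :=
    meet_planes (W2' _ w2W) (Wann _ _ w2W w2W) fr pw2.
- by rewrite wedgeA wedge_vecC -w0E wedgeNl Wann ?oppr0.
- by rewrite wedgeA -w1E Wann.
have E c t : wedge (extvec p) (extvec (c - t *: p)) =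
    wedge (extvec p) (extvec c).
  rewrite [extvec (_ - _)]linearB /= [extvec (_ *: _)]linearZ /=.
  by rewrite wedgeDr wedgeNr wedgeZr wedge_sq scaler0 subr0.
right; exists p, (a - k' *: p), (v - l *: p); split=> //.
have tW : (triangle p (a - k' *: p) (v - l *: p) <= W)%VS.
  apply/span_subvP => u; rewrite !inE => /or3P[] /eqP ->.
  - by rewrite E wedge_vecC -w0E rpredN.
  - by rewrite -[X in X \in _](scalerK m0) -w2E rpredZ.
  - by rewrite wedge_vecC E -w1E rpredN.
apply: subv_anti; rewrite tW andbT; apply/subvP=> w wW.
apply: mem_triangle => //; [exact: W2'|exact: Wann|] => u /(subvP tW) uW.
exact: Wann.
Qed.

End Products.

(** The equality case of (1) is an equivalence for each [w], so that [W] is a full star: a proper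
    subspace of a star consists of multiples of [a] too, but has smaller dimension. *)
Theorem theorem1 (R : realType) (n : nat) (hn : (5 <= n)%N)
    (W : {vspace exterior R n}) (hW2 : (W <= extpow R n 2)%VS)
    (hW : self_annihilating W) :
  ((\dim W <= n - 1)%N /\
   (\dim W = (n - 1)%N <->
    exists2 a : 'rV[R]_n, a != 0 &
      forall w : exterior R n,
        w \in W <-> exists v : 'rV[R]_n, w = wedge (extvec a) (extvec v))) /\
  (~ (exists a : 'rV[R]_n,
        forall w : exterior R n,
          w \in W -> exists v : 'rV[R]_n, w = wedge (extvec a) (extvec v)) ->
   (\dim W <= 3)%N /\
   (\dim W = 3%N <->
    exists x1 x2 x3 : 'rV[R]_n,
      free [:: x1; x2; x3] /\
      W = <<[:: wedge (extvec x1) (extvec x2);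
                wedge (extvec x2) (extvec x3);
                wedge (extvec x3) (extvec x1)]>>%VS)).
Proof.
(* Here [5 <= n] enters: a triangle has dimension strictly below that of a full star. *)
have n4 : (3 < n - 1)%N by rewrite ltn_subRL.
have dimW0 a : in_star a W -> \dim W != 0%N -> a != 0.
  by move=> aW; apply: contraNneq => a0; rewrite a0 in aW;
     rewrite (in_star0 aW) dimv0.
have [[a aW]|[x1 [x2 [x3 [fr WE]]]]] := star_or_triangle hW2 hW; last first.
  have dW : \dim W = 3%N by rewrite WE dim_triangle.
  (* For a triangle, both sides of the equivalence in (2) hold outright. *)
  split; last by split; [rewrite dW|split=> // _; exists x1, x2, x3].
  split; first by rewrite dW ltnW.
  split=> [dWn|[a a0 aW]]; first by rewrite -dWn dW ltnn in n4.
  by rewrite -(dim_star a0); congr (\dim _); apply/vspaceP=> w;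
     apply/idP/idP => [/aW/mem_star|/mem_star/aW].
split; last by case; exists a.
split.
  (* The zero space is set apart because its [a] may be zero. *)
  have [->|/(dimW0 a aW)] := eqVneq (\dim W) 0%N; first by [].
  exact: dim_in_star.
split=> [dWn|[b b0 bW]].
  have a0 : a != 0 by apply: dimW0 => //; rewrite dWn -lt0n (leq_trans _ n4).
  (* Inclusion in the star together with equal dimensions. *)
  have -> : W = star a.
    apply/eqP; rewrite eqEdim dim_star // dWn leqnn andbT.
    by apply/subvP=> w /aW/mem_star.
  by exists a => // w; apply: mem_star.
by rewrite -(dim_star b0); congr (\dim _); apply/vspaceP=> w;
   apply/idP/idP => [/bW/mem_star|/mem_star/bW].
Qed.
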